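(* Let $R$ be a multiplicative hyperring. Every maximal hyperideal of $R$ is a quasi $J$-prime hyperideal if and only if $R$ is a local hyperring.
   Context: A multiplicative hyperring is a nonempty set $R$ with an operation $+$ and a hyperoperation $\circ: R\times R\to P^*(R)$ (where $P^*(R)$ is the set of nonempty subsets of $R$) such that: $(R,+)$ is an abelian group; $\circ$ is associative; $a\circ(b+c)\subseteq a\circ b+a\circ c$ and $(b+c)\circ a\subseteq b\circ a+c\circ a$; and $a\circ(-b)=(-a)\circ b=-(a\circ b)$ for all $a,b,c\in R$. For nonempty subsets $A,B\subseteq R$, $A\circ B=\bigcup_{x\in A,\,y\in B}x\circ y$, and $A\circ r=A\circ\{r\}$. Standing assumptions: $R$ is commutative with an identity $1$, meaning $a\in a\circ 1$ for all $a\in R$. A hyperideal of $R$ is a nonempty subset $I\subseteq R$ with $a-b\in I$ for $a,b\in I$ and $r\circ x\subseteq I$ for $x\in I$, $r\in R$. Let $\mathbf{C}=\{r_1\circ r_2\circ\cdots\circ r_n : r_i\in R,\ n\in\mathbb{N}\}$; a hyperideal $I$ is a $\mathbf{C}$-hyperideal if for every $A\in\mathbf{C}$, $A\cap I\neq\varnothing$ implies $A\subseteq I$. Standing assumption: all hyperideals are $\mathbf{C}$-hyperideals. A proper hyperideal $M$ is maximal if every hyperideal $N$ with $M\subsetneq N\subseteq R$ equals $R$; $R$ is local if it has just one maximal hyperideal; the Jacobson radical $J(R)$ is the intersection of all maximal hyperideals of $R$. A proper hyperideal $P$ is prime if $x\circ y\subseteq P$ with $x,y\in R$ implies $x\in P$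 or $y\in P$. $\sqrt{I}$ is the intersection of all prime hyperideals of $R$ containing $I$ (and $\sqrt{I}=R$ if there are none). A proper hyperideal $I$ is $J$-prime if for all $x,y\in R$, $x\circ y\subseteq I$ implies $x\in J(R)$ or $y\in I$. A proper hyperideal $I$ is quasi $J$-prime if $\sqrt{I}$ is $J$-prime.
   Formalization: The formal theorem additionally assumes that R has a proper hyperideal; without this (e.g. R = {0}, or a∘b = R for all a, b) there are no maximal hyperideals, so the left side holds vacuously while R is not local. *)

(* Defs.v *)
From HB Require Import structures.
From mathcomp Require Import all_boot all_order all_algebra.
From mathcomp Require Import all_classical.

Set Implicit Arguments.
Unset Strict Implicit.
Unset Printing Implicit Defensive.

Import GRing.Theory.

Local Open Scope classical_set_scope.
Local Open Scope ring_scope.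

Definition set_hmul (R : Type) (op : R -> R -> set R) (A B : set R) : set R :=
  \bigcup_(x in A) \bigcup_(y in B) op x y.

HB.mixin Record Zmodule_isMultHyperring R of GRing.Zmodule R := {
  hmul : R -> R -> set R;
  hmul_neq0 : forall a b, hmul a b !=set0;
  hmulA : forall a b c,
    set_hmul hmul (hmul a b) [set c] = set_hmul hmul [set a] (hmul b c);
  hmulDr : forall a b c,
    hmul a (b + c) `<=` [set x + y | x in hmul a b & y in hmul a c];
  hmulDl : forall a b c,
    hmul (b + c) a `<=` [set x + y | x in hmul b a & y in hmul c a];
  hmulrN : forall a b, hmul a (- b) = [set - x | x in hmul a b];
  hmulNr : forall a b, hmul (- a) b = [set - x | x in hmul a b];
}.

#[short(type="multHyperringType")]
HB.structure Definition MultHyperring :=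
  {R of GRing.Zmodule R & Zmodule_isMultHyperring R}.

(* The identity is only required to satisfy a \in a o 1; it need not be unique
   and a o 1 need not be a singleton. *)
HB.mixin Record MultHyperring_isComUnital R of MultHyperring R := {
  hone : R;
  hmulC : forall a b : R, hmul a b = hmul b a;
  hmul1 : forall a : R, hmul a hone a;
}.

#[short(type="comMultHyperringType")]
HB.structure Definition ComMultHyperring :=
  {R of MultHyperring R & MultHyperring_isComUnital R}.

Section Hyperideals.
Variable R : comMultHyperringType.
Implicit Types (I M P A : set R).

Definition hyperideal I : Prop :=
  [/\ I !=set0,
      forall a b, I a -> I b -> I (a - b)
    & forall r x, I x -> hmul r x `<=` I].

(* The product r o s_1 o ... o s_k; for s empty it is the singleton [set r]. *)
Definition hprod (r : R) (s : seq R) : set R :=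
  foldl (fun A t => set_hmul hmul A [set t]) [set r] s.

Definition finite_hproducts : set (set R) :=
  [set A | exists r s, A = hprod r s].

Definition C_hyperideal I : Prop :=
  hyperideal I /\
  forall A, finite_hproducts A -> A `&` I !=set0 -> A `<=` I.

Definition proper_hyperideal I : Prop := hyperideal I /\ I <> setT.

Definition maximal_hyperideal M : Prop :=
  proper_hyperideal M /\
  forall N, hyperideal N -> M `<` N -> N = setT.

Definition prime_hyperideal P : Prop :=
  proper_hyperideal P /\
  forall x y, hmul x y `<=` P -> P x \/ P y.

(* Equal to setT when no prime hyperideal contains I. *)
Definition hyperradical I : set R :=
  \bigcap_(P in [set P | prime_hyperideal P /\ I `<=` P]) P.

(* Equal to setT when there is no maximal hyperideal. *)
Definition hyperjacobson : set R :=
  \bigcap_(M in [set M | maximal_hyperideal M]) M.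

Definition J_prime I : Prop :=
  proper_hyperideal I /\
  forall x y, hmul x y `<=` I -> hyperjacobson x \/ I y.

Definition quasi_J_prime I : Prop :=
  proper_hyperideal I /\ J_prime (hyperradical I).

End Hyperideals.

Definition local_hyperring (R : comMultHyperringType) : Prop :=
  exists! M : set R, maximal_hyperideal M.

(* Main.v *)
Require Import Defs.
From mathcomp Require Import all_boot all_order all_algebra.
From mathcomp Require Import all_classical.

(** A J-prime hyperideal [I] lies in the Jacobson radical: for [x] in [I] the
    product [hmul x hone] is contained in [I], and [hone] is not in [I], so
    [x] is in the radical ([J_prime_sub_jacobson]).  If every maximal
    hyperideal is quasi J-prime, apply this to the radical of a maximal [M],
    which contains [M]: then [M] is contained in every maximal hyperideal, and
    so equals each of them ([maximal_sub_eq]).  That there is one at all is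
    Zorn's lemma ([exists_maximal]).

    If [M] is the only maximal hyperideal, then it is the Jacobson radical, and
    it is prime, as all maximal hyperideals are ([maximal_prime]).  So [M] is
    its own radical, and its being J-prime is just its being prime. *)

Section MaximalHyperideals.
Local Open Scope classical_set_scope.
Local Open Scope ring_scope.
Context {R : comMultHyperringType}.
Implicit Types (I M N P : set R).

Lemma hyperideal_one {I} : hyperideal I -> I hone -> I = setT.
Proof.
move=> [_ _ Imul] I1; apply/seteqP; split=> // r _.
exact: Imul I1 _ (hmul1 r).
Qed.

Lemma proper_not_one {I} : proper_hyperideal I -> ~ I hone.
Proof. by move=> [hI nT] /(hyperideal_one hI). Qed.

Lemma maximal_sub_eq {M N} :
  maximal_hyperideal M -> proper_hyperideal N -> M `<=` N -> M = N.
Proof.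
move=> [_ Mmax] [hN nT] MN; apply: contrapT => neq; apply/nT/(Mmax _ hN).
by split=> // NM; apply: neq; apply/seteqP.
Qed.

Lemma hyperradical_sup I : I `<=` hyperradical I.
Proof. by move=> x Ix P [_ /(_ x Ix)]. Qed.

Lemma prime_hyperradical P : prime_hyperideal P -> hyperradical P = P.
Proof.
move=> pP; apply/seteqP; split=> [x rx|]; last exact: hyperradical_sup.
exact: rx P (conj pP (fun _ => id)).
Qed.

(** An increasing union of proper hyperideals is proper because none of them
    contains [hone]. *)
Lemma exists_maximal :
  (exists I : set R, proper_hyperideal I) ->
  exists M : set R, maximal_hyperideal M.
Proof.
move=> [I pI].
(* The empty union must be allowed, so nonemptiness is left out of [Q]; it
   comes back for a maximal element, which is not strictly below [I]. *)
pose Q : set (set R) := [set A | [/\ ~ A hone,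
  forall a b, A a -> A b -> A (a - b) & forall r x, A x -> hmul r x `<=` A]].
have proper_Q N : proper_hyperideal N -> Q N.
  by move=> pN; split; [exact: proper_not_one | case: pN => -[] ..].
have [F FQ Ftot|M [[M1 Msub Mmul] Mmax]] := @Zorn_bigcup R Q.
  split.
  - by move=> [A FA]; case: (FQ A FA).
  - move=> a b [A FA Aa] [B FB Bb].
    have [AB|BA] := Ftot A B FA FB.
    + by exists B => //; case: (FQ B FB) => _ Bsub _;
      apply: Bsub => //; exact: AB.
    + by exists A => //; case: (FQ A FA) => _ Asub _;
      apply: Asub => //; exact: BA.
  - move=> r x [A FA Ax] y yrx; exists A => //.
    by case: (FQ A FA) => _ _ Amul; exact: Amul Ax _ yrx.
have M0 : M !=set0.
  apply: contrapT => /nonemptyPn ME; apply: (Mmax I); last exact: proper_Q.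
  case: pI => -[[x Ix] _ _] _.
  by split; rewrite ME // => /(_ x Ix).
exists M; split; first by split=> // MT; apply: M1; rewrite MT.
move=> N hN MN; apply: contrapT => nT.
exact: Mmax MN (proper_Q _ (conj hN nT)).
Qed.

Lemma hyperidealN I a : hyperideal I -> I a -> I (- a).
Proof.
move=> [_ Isub _] Ia; rewrite -GRing.sub0r; apply: (Isub) => //.
by rewrite -(GRing.subrr a); apply: Isub.
Qed.

Lemma hyperidealD I a b : hyperideal I -> I a -> I b -> I (a + b).
Proof.
move=> hI Ia Ib; rewrite -[b]GRing.opprK.
by case: (hI) => _ Isub _; apply: Isub => //; exact: hyperidealN.
Qed.

Lemma colon_hyperideal I y :
  hyperideal I -> hyperideal [set t | hmul t y `<=` I].
Proof.
move=> hI; have [[z Iz] Isub Imul] := hI; split.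
- by exists z => /=; rewrite hmulC; exact: Imul.
- move=> a b ayI byI u /hmulDl [v av [w]].
  rewrite hmulNr => -[w' bw' <-] <-.
  by apply: hyperidealD => //; [exact: ayI | apply: hyperidealN => //;
    exact: byI].
- move=> r x xyI t rxt u tyu.
  have : set_hmul hmul (hmul r x) [set y] u by exists t => //; exists y.
  by rewrite hmulA => -[_ -> [v xyv ruv]]; apply: (Imul r v) ruv; exact: xyI.
Qed.

(** If [hmul x y] is contained in [M], the colon hyperideal of [y] contains
    both [M] and [x].  When [x] is outside [M] it is thus the whole hyperring,
    so it contains [hone], which means that [y] lies in [M].  Working with the
    colon avoids describing the hyperideal generated by [M] and [x]. *)
Lemma maximal_prime M : maximal_hyperideal M -> prime_hyperideal M.
Proof.
move=> [pM Mmax]; split=> // x y xyM; have [hM _] := pM.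
have [Mx|nMx] := pselect (M x); [by left | right].
have colonT : [set t | hmul t y `<=` M] = setT.
  apply: Mmax; first exact: colon_hyperideal.
  split=> [t Mt u|/(_ x xyM)//].
  by rewrite hmulC; case: hM => _ _; apply.
have : [set t | hmul t y `<=` M] hone by rewrite colonT.
by apply; rewrite hmulC; exact: hmul1.
Qed.

Lemma J_prime_sub_jacobson I : J_prime I -> I `<=` hyperjacobson (R := R).
Proof.
move=> [pI IJ] x Ix; case: (IJ x hone) => // [|/(proper_not_one pI)//].
by rewrite hmulC; case: pI => -[_ _ Imul] _; exact: Imul.
Qed.

Lemma unique_maximal_jacobson M :
  unique (@maximal_hyperideal R) M -> hyperjacobson (R := R) = M.
Proof.
move=> [mM Muniq]; apply/seteqP; split=> [x|x Mx N mN]; first exact.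
by rewrite -(Muniq N).
Qed.

End MaximalHyperideals.

Theorem theorem4p11 (R : comMultHyperringType)
    (all_C : forall I : set R, hyperideal I -> C_hyperideal I)
    (has_proper : exists I : set R, proper_hyperideal I) :
  (forall M : set R, maximal_hyperideal M -> quasi_J_prime M) <->
  local_hyperring R.
Proof.
split=> [qJ|[M uM] N mN].
- have [M mM] := exists_maximal has_proper.
  exists M; split=> // N mN; have [_ JM] := qJ M mM.
  apply: (maximal_sub_eq mM mN.1) => x Mx.
  apply: (J_prime_sub_jacobson _ JM x _ N mN).
  exact: hyperradical_sup.
- have pN := maximal_prime _ mN.
  split; first exact: mN.1.
  rewrite (prime_hyperradical _ pN); split; first exact: mN.1.
  rewrite (unique_maximal_jacobson _ uM) (uM.2 N mN).
  exact: pN.2.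
Qed.
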